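(* Let $R$ be a commutative ring with identity. Then $\mathrm{fPD}(R)\leq \dim(R)$.
   Context: $\dim(R)$ denotes the Krull dimension of $R$ (possibly $\infty$). Small finitistic dimension: an $R$-module $M$ has a finite projective resolution if there are an integer $n$ and an exact sequence $0\to P_n\to P_{n-1}\to\cdots\to P_1\to P_0\to M\to 0$ with every $P_i$ a finitely generated projective $R$-module. $\mathrm{fPD}(R)$ is the supremum of the projective dimensions of all $R$-modules having a finite projective resolution (possibly $\infty$). *)

(* Defs.v *)
From mathcomp Require Import all_boot all_order all_algebra.
From mathcomp Require Import boolp classical_sets constructive_ereal.

Set Implicit Arguments.
Unset Strict Implicit.
Unset Printing Implicit Defensive.

Import Order.TTheory GRing.Theory Num.Theory.
Local Open Scope classical_set_scope.
Local Open Scope ring_scope.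

(* Least upper and greatest lower bounds in \bar int: ereal_sup and ereal_inf *)
(* are only available over a realFieldType. The lemmas below show that the   *)
(* bounds always exist, so that the default values of supremum and infimum   *)
(* only serve for the empty set.                                             *)
Definition eint_sup (S : set (\bar int)) : \bar int := supremum -oo%E S.
Definition eint_inf (S : set (\bar int)) : \bar int := infimum +oo%E S.

Lemma eint_sup_supremums (S : set (\bar int)) : supremums S (eint_sup S).
Proof.
rewrite /eint_sup /supremum; case: ifPn => [/eqP ->|S0].
  by split => // y _; rewrite leNye.
suff [y Sy] : exists y, supremums S y.
  by case: xgetP => [z _ //|/(_ y)].
have [[m Sm]|nb] := pselect (exists m : int, ubound S m%:E); last first.
  exists +oo%E; split => [x _|[y|//|] Sy]; first by rewrite leey.
    by case: nb; exists y.
  by case: nb; exists 0 => x /Sy; rewrite leeNy_eq => /eqP ->; rewrite leNye.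
have [[k Sk]|nf] := pselect (exists k : int, S k%:E); last first.
  exists -oo%E; split => [[x|//|//] Sx|y _]; last by rewrite leNye.
  - by case: nf; exists x.
  - by have := Sm _ Sx; rewrite leye_eq.
have km : k <= m by have := Sm _ Sk; rewrite lee_fin.
pose Q n := `[< ubound S (k + n%:Z)%:E >].
have exQ : exists n, Q n.
  exists `|m - k|%N; apply/asboolP.
  by rewrite gez0_abs ?subr_ge0 // addrCA subrr addr0.
case: (ex_minnP exQ) => n /asboolP Qn minn.
exists (k + n%:Z)%:E; split => // -[y||] uby; last 2 first.
- by rewrite leey.
- by have := uby _ Sk; rewrite leeNy_eq.
rewrite lee_fin; have ky : k <= y by have := uby _ Sk; rewrite lee_fin.
have /minn : Q `|y - k|%N.
  by apply/asboolP; rewrite gez0_abs ?subr_ge0 // addrCA subrr addr0.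
by rewrite -lez_nat gez0_abs ?subr_ge0 // lerBrDl.
Qed.

Lemma eint_inf_infimums (S : set (\bar int)) : infimums S (eint_inf S).
Proof.
rewrite /eint_inf /infimum; case: ifPn => [/eqP ->|S0].
  by split => // y _; rewrite leey.
suff [y Sy] : exists y, infimums S y.
  by case: xgetP => [z _ //|/(_ y)].
have [ubS lubS] := eint_sup_supremums [set (- x)%E | x in S].
exists (- eint_sup [set (- x)%E | x in S])%E; split => [x Sx|y lby].
  by rewrite leeNl; apply: ubS; exists x.
by rewrite leeNr; apply: lubS => _ [x Sx <-]; rewrite leeN2; apply: lby.
Qed.

Section KrullDimension.
Variable R : comPzRingType.

Definition ideal (I : set R) : Prop :=
  [/\ I 0, forall x y, I x -> I y -> I (x + y) & forall a x, I x -> I (a * x)].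

Definition prime_ideal (I : set R) : Prop :=
  [/\ ideal I, ~ I 1 & forall x y, I (x * y) -> I x \/ I y].

Definition has_prime_chain (n : nat) : Prop :=
  exists p : nat -> set R,
    (forall i, (i <= n)%N -> prime_ideal (p i)) /\
    (forall i, (i < n)%N -> p i `<` p i.+1).

(* The zero ring, having no prime ideal, has Krull dimension -oo. *)
Definition krull_dim : \bar int :=
  eint_sup [set n%:Z%:E | n in has_prime_chain].

End KrullDimension.

Section FinitisticDimension.
Variable R : comPzRingType.

Definition zero_module (M : lmodType R) : Prop := forall x : M, x = 0.

Definition finitely_generated (M : lmodType R) : Prop :=
  exists (n : nat) (g : 'I_n -> M),
    forall x : M, exists a : 'I_n -> R, x = \sum_(i < n) a i *: g i.

Definition projective (P : lmodType R) : Prop :=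
  forall (N N' : lmodType R) (g : {linear N -> N'}) (f : {linear P -> N'}),
    (forall y : N', exists x : N, g x = y) ->
    exists h : {linear P -> N}, forall x : P, g (h x) = f x.

(* An exact sequence 0 -> P_n -> ... -> P_0 -> M -> 0 with all P_i in C; the *)
(* sequence is extended by P_i = 0 for i > n. Both classes C used below      *)
(* contain the zero modules, so that the extension adds no constraint.       *)
Definition has_resolution (C : lmodType R -> Prop) (M : lmodType R) (n : nat)
    : Prop :=
  exists (P : nat -> lmodType R) (d : forall i, {linear P i.+1 -> P i})
         (e : {linear P 0%N -> M}),
    [/\ forall i, C (P i),
        forall i, (n < i)%N -> zero_module (P i),
        forall y : M, exists x, e x = y,
        forall x, e x = 0 <-> exists y, d 0%N y = x
      & forall i x, d i x = 0 <-> exists y, d i.+1 y = x].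

(* With the usual convention that the zero module has dimension -oo. *)
Definition proj_dim (M : lmodType R) : \bar int :=
  if `[< zero_module M >] then -oo%E
  else eint_inf [set n%:Z%:E | n in has_resolution projective M].

Definition has_finite_proj_resolution (M : lmodType R) : Prop :=
  exists n, has_resolution
    (fun P => finitely_generated P /\ projective P) M n.

Definition fPD : \bar int :=
  eint_sup [set v | exists2 M : lmodType R,
                      has_finite_proj_resolution M & v = proj_dim M].

End FinitisticDimension.

(* Main.v *)
(** Let [d : F_m -> F_(m-1)] be the leftmost map of a finite projective
    resolution with [m > n = dim R]. It suffices to split [d]: the resolution
    can then be shortened. The scalars [r] for which [r * id] factors through
    [d] form an ideal; if it is proper, it lies in a prime [P], and it contains
    the maximal minors of [d], so these lie in [P]. Kronecker's theorem gives
    [y_0, ..., y_(n-1)] in [P] generating, locally at [P] and up to radical, an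
    ideal that contains these minors. Consider the Koszul complex [K] of [y]
    and show [H_q(K)_P = 0] by descending induction on [q]. If the homology
    vanishes above [q], a chase through the double complex [F (x) K], which
    works because [m > n], shows that [d] is injective on [F_m (x) H_q(K)_P];
    but [y], and hence a power of each minor, kills [H_q(K)_P], so by McCoy's
    theorem [H_q(K)_P = 0]. For [q = 0] this contradicts [y_i \in P]. *)
From HB Require Import structures.
Require Import Defs.
From mathcomp Require Import all_boot all_order all_algebra.
From mathcomp Require Import boolp classical_sets constructive_ereal.
From mathcomp Require Import ring.

Set Implicit Arguments.
Unset Strict Implicit.
Unset Printing Implicit Defensive.

Import Order.TTheory GRing.Theory Num.Theory.
Local Open Scope classical_set_scope.
Local Open Scope ring_scope.

(** * Kronecker's theorem *)

Section Ideals.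
Variable R : comPzRingType.
Implicit Types (I J P Q : set R) (y : nat -> R).

Lemma idealN I x : ideal I -> I x -> I (- x).
Proof. by case=> _ _ IM Ix; rewrite -mulN1r; apply: (IM). Qed.

Lemma idealB I x z : ideal I -> I x -> I z -> I (x - z).
Proof.
by move=> Ii Ix Iz; case: (Ii) => _ ID _; apply: (ID) => //; apply: idealN.
Qed.

Lemma ideal_sum I (T : finType) (F : T -> R) :
  ideal I -> (forall i, I (F i)) -> I (\sum_i F i).
Proof. by case=> I0 ID _ FI; apply: (big_ind I). Qed.

Lemma prime_notinM P x z : prime_ideal P -> ~ P x -> ~ P z -> ~ P (x * z).
Proof. by case=> _ _ Pp Px Pz /Pp[]. Qed.

Lemma prime_notin1 P : prime_ideal P -> ~ P 1.
Proof. by case. Qed.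

(** An ideal maximal among those that contain [I] and miss the multiplicative set [S] is prime. *)
Lemma exists_prime I (S : set R) : ideal I -> S 1 ->
    (forall x z, S x -> S z -> S (x * z)) -> (forall x, I x -> ~ S x) ->
  exists P, [/\ prime_ideal P, I `<=` P & forall x, P x -> ~ S x].
Proof.
move=> Ii S1 SM IS.
pose good J := [/\ ideal J, I `<=` J & forall x, J x -> ~ S x].
have [F FP Ftot|A [[->|gA] Amax]] :=
    @Zorn_bigcup R [set J | J = set0 \/ good J].
- have [[J [FJ gJ]]|noJ] := pselect (exists J, F J /\ good J); last first.
    left; apply/seteqP; split=> // x [J FJ Jx].
    by case: (FP _ FJ) => [J0|gJ]; [rewrite J0 in Jx|case: noJ; exists J].
  have Fgood K x : F K -> K x -> good K.
    by move=> /FP[->|].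
  right; split.
  + split; first by exists J => //; case: gJ => -[].
    * move=> x z [K FK Kx] [L FL Lz].
      have [[Ki _ _] [Li _ _]] := (Fgood _ _ FK Kx, Fgood _ _ FL Lz).
      by have [KL|LK] := Ftot _ _ FK FL; [exists L => //; case: Li => _ + _|
        exists K => //; case: Ki => _ + _]; apply => //; [apply: KL|apply: LK].
    * move=> a x [K FK Kx]; exists K => //.
      by have [[_ _ KM] _ _] := Fgood _ _ FK Kx; apply: KM.
  + by move=> x Ix; exists J => //; case: gJ => _ + _; apply.
  + by move=> x [K FK Kx]; have [_ _] := Fgood _ _ FK Kx; apply.
- exfalso; apply: (Amax I); last by right; split.
  by split=> // /(_ 0); apply; case: Ii.
- have [Ai IA AS] := gA; have [A0 AD AM] := Ai.
  (* Adjoining [x \notin A] to the maximal [A] produces an element of [S]. *)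
  have key x : ~ A x -> exists a c, A a /\ S (a + c * x).
    move=> nAx; apply: contrapT => nex.
    apply: (Amax [set w | exists2 a, A a & exists c, w = a + c * x]).
      split=> [w Aw|]; first by exists w => //; exists 0; rewrite mul0r addr0.
      move=> /(_ x) xA; apply/nAx/xA; exists 0 => //; exists 1.
      by rewrite mul1r add0r.
    right; split.
    + split.
      * by exists 0 => //; exists 0; rewrite mul0r addr0.
      * move=> _ _ [a Aa [c ->]] [b Ab [e ->]].
        by exists (a + b); [apply: (AD)|exists (c + e); ring].
      * move=> b _ [a Aa [c ->]].
        by exists (b * a); [apply: (AM)|exists (b * c); ring].
    + by move=> w Iw; exists w; [apply: IA|exists 0; rewrite mul0r addr0].
    + by move=> _ [a Aa [c ->]] Sx; apply: nex; exists a, c.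
  exists A; split=> //; split=> // [A1|x z Axz]; first exact: AS A1 S1.
  apply: contrapT => /not_orP[/key[a [c [Aa Sa]]] /key[b [e [Ab Sb]]]].
  apply: (AS _ _ (SM _ _ Sa Sb)).
  rewrite (_ : _ * _ = (b + e * z) * a + (c * x) * b + (c * e) * (x * z)).
    by apply: (AD); [apply: (AD)|]; apply: (AM).
  by ring.
Qed.

(** Modulo [Q], [X] is [b * r], so [s * X ^+ k] is a multiple of [s * b ^+ k]. *)
Lemma ideal_pow_trans Q s b k X r :
  ideal Q -> Q (X - b * r) -> Q (s * b ^+ k) -> Q (s * X ^+ k).
Proof.
move=> [Q0 QD QM] QX Qb.
rewrite -(subrK (s * (b * r) ^+ k) (s * X ^+ k)) -mulrBr subrXX.
apply: (QD); first by rewrite mulrCA mulrC; apply: (QM).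
by rewrite exprMn mulrA mulrC; apply: (QM).
Qed.

Definition span I n y : set R :=
  [set r | exists c : nat -> R, I (r - \sum_(i < n) c i * y i)].

Lemma span_ideal I n y : ideal I -> ideal (span I n y).
Proof.
move=> [I0 ID IM]; split.
- by exists (fun=> 0); rewrite big1 ?subr0 // => i _; rewrite mul0r.
- move=> x z [c cx] [e ez]; exists (fun i => c i + e i).
  under eq_bigr do rewrite mulrDl.
  by rewrite big_split opprD addrACA; apply: (ID).
- move=> a x [c cx]; exists (fun i => a * c i).
  under eq_bigr do rewrite -mulrA.
  by rewrite -mulr_sumr -mulrBr; apply: (IM).
Qed.

Lemma span_sub I n y : I `<=` span I n y.
Proof.
by move=> x Ix; exists (fun=> 0); rewrite big1 ?subr0 // => i _; rewrite mul0r.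
Qed.

Lemma span_gen I n y i : ideal I -> (i < n)%N -> span I n y (y i).
Proof.
move=> [I0 _ _] lt_in; exists (fun j => (j == i)%:R).
rewrite (bigD1 (Ordinal lt_in)) //= eqxx mul1r big1 ?addr0 ?subrr //.
by move=> j /eqP ne; rewrite (_ : _ == _ = false) ?mul0r //;
  apply/eqP => ji; apply/ne/val_inj.
Qed.

(** A chain of length [n] in the spectrum of the localisation of [R/I] at [P]. *)
Definition prime_chain I P n : Prop :=
  exists p : nat -> set R,
    (forall i, (i <= n)%N -> [/\ prime_ideal (p i), I `<=` p i & p i `<=` P]) /\
    (forall i, (i < n)%N -> p i `<` p i.+1).

(** In the localisation at [P], [a] lies in the radical of the extension of [J]. *)
Definition loc_nilpotent P J a := exists s k, ~ P s /\ J (s * a ^+ k).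

(* [I : b^oo] + (b), the boundary ideal of [b] modulo [I] *)
Definition boundary I b : set R :=
  [set w | exists r k, I ((w - r * b) * b ^+ k)].

Lemma boundary_ideal I b : ideal I -> ideal (boundary I b).
Proof.
move=> [I0 ID IM]; split.
- by exists 0, 0%N; rewrite mul0r subr0 mul0r.
- move=> x z [r [k Ix]] [r' [l Iz]]; exists (r + r'), (k + l)%N.
  rewrite (_ : _ * _ = b ^+ l * ((x - r * b) * b ^+ k)
                     + b ^+ k * ((z - r' * b) * b ^+ l)).
    by apply: (ID); apply: (IM).
  by rewrite exprD; ring.
- move=> a x [r [k Ix]]; exists (a * r), k.
  by rewrite -mulrA -mulrBr -mulrA; apply: (IM).
Qed.

(** Since [I : b^oo] lies in [P], [I] misses all [t * b ^+ k] with [t] outside [P]. A prime [Q] over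
    [I] missing them too lies in [P] and omits [b], which [P] contains. *)
Lemma boundary_prime I b P : ideal I -> prime_ideal P -> boundary I b `<=` P ->
  exists Q, [/\ prime_ideal Q, I `<=` Q & Q `<` P].
Proof.
move=> Ii pP bP; have [Pi nP1 _] := pP.
pose S := [set w | exists2 t, ~ P t & exists k, w = t * b ^+ k].
have [|||Q [pQ IQ QS]] := @exists_prime I S Ii.
- by exists 1 => //; exists 0%N; rewrite mul1r.
- move=> _ _ [t Pt [k ->]] [u Pu [l ->]]; exists (t * u).
    exact: prime_notinM.
  by exists (k + l)%N; rewrite exprD; ring.
- move=> w Iw [t Pt [k wE]]; rewrite wE in Iw; apply: Pt; apply: bP.
  by exists 0, k; rewrite mul0r subr0.
exists Q; split=> //; split=> [x Qx|PQ].
  by apply: contrapT => nPx; apply: (QS _ Qx); exists x => //; exists 0%N;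
    rewrite mulr1.
apply: (QS b); last by exists 1 => //; exists 1%N; rewrite mul1r.
apply/PQ/bP; exists 1, 0%N.
by rewrite mul1r subrr mul0r; case: Ii.
Qed.

(** Passing to the boundary ideal lowers the local dimension: a chain above it gains a prime at the
    bottom. *)
Lemma boundary_prime_chain I b P n : ideal I ->
  prime_chain (boundary I b) P n -> prime_chain I P n.+1.
Proof.
move=> Ii [p [pp plt]]; have [p0 b0 P0] := pp 0%N isT.
have [Q [pQ IQ [Qp pQn]]] := boundary_prime Ii p0 b0.
exists (fun i => if i is j.+1 then p j else Q); split; last by case.
move=> [_|i /pp[ppi bi Pi]]; first by split=> // x /Qp/P0.
split=> // x Ix; apply: bi; exists 0, 0%N.
by rewrite mul0r subr0 mulr1.
Qed.

(** Induction on the local dimension of [R/I], replacing [I] by the boundary ideal of the last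
    [b]. *)
Lemma Kronecker_step n I P : ideal I -> prime_ideal P ->
    ~ prime_chain I P n.+1 -> forall (b : nat -> R) a, P a ->
  exists x, loc_nilpotent P (span I n (fun i => b i + a * x i)) a.
Proof.
elim: n I => [|n IH] I Ii pP nch b a Pa; have [I0 ID IM] := Ii.
  (* If no [t * a ^+ k] with [t] outside [P] is in [I], a prime avoiding all of them is strictly
     below [P], as [a] is in [P]: a chain of length 1. *)
  exists (fun=> 0); apply: contrapT => nnil.
  pose S := [set w | exists2 t, ~ P t & exists k, w = t * a ^+ k].
  have [|||Q [pQ IQ QS]] := @exists_prime I S Ii.
  - by exists 1; [exact: prime_notin1|exists 0%N; rewrite mul1r].
  - move=> _ _ [t Pt [k ->]] [u Pu [l ->]]; exists (t * u).
      exact: prime_notinM.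
    by exists (k + l)%N; rewrite exprD; ring.
  - move=> w Iw [t Pt [k wE]]; rewrite wE in Iw.
    apply: nnil; exists t, k; split=> //.
    exact: span_sub.
  have QP : Q `<=` P.
    move=> x Qx; apply: contrapT => nPx; apply: (QS _ Qx).
    by exists x => //; exists 0%N; rewrite mulr1.
  apply: nch; exists (fun i => if i is 0 then Q else P); split.
    by case=> [|i] _; split=> // x /IQ/QP.
  move=> [_|//]; split=> // PQ; apply: (QS a (PQ _ Pa)).
  by exists 1; [exact: prime_notin1|exists 1%N; rewrite mul1r].
have [|x [s [k [Ps [c [r [l]]]]]]] :=
    IH _ (boundary_ideal (b n) Ii) pP _ b a Pa.
  by move=> /(boundary_prime_chain Ii).
set y := fun i : nat => b i + a * x i; set z := _ - r * _ => Iz.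
(* The error term [z] of the induction hypothesis serves as the last coefficient, because a power of
   [b n] multiplies it into [I]. *)
exists (fun i => if (i < n)%N then x i else z).
set y' := fun i : nat => _; pose Q := span I n.+1 y'.
have Qi : ideal Q by exact: span_ideal.
have [Q0 QD QM] := Qi.
have Qyn : Q (b n + a * z).
  by have := span_gen y' Ii (ltnSn n); rewrite /y' ltnn.
have Qy i : (i < n)%N -> Q (y i).
  by move=> ltin; have := span_gen y' Ii (leqW ltin); rewrite /y' ltin.
have Qb : Q (1 * b n ^+ l.+1).
  rewrite (_ : _ * _ = b n ^+ l * (b n + a * z) - a * (z * b n ^+ l)).
    by apply: idealB => //; apply: (QM) => //; apply: span_sub.
  by rewrite exprS; ring.
(* Modulo [Q], [s * a ^+ k.+1] is [a * (z + r * b n)], and [a * z] is [- b n]. So it is a multiple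
   of [b n], which is nilpotent by [Qb]. *)
have QX : Q (s * a ^+ k.+1 - b n * (a * r - 1)).
  rewrite (_ : _ - _ = (b n + a * z) + a * \sum_(i < n) c i * y i).
    apply: (QD) => //; apply: (QM); apply: ideal_sum => // i.
    by apply: (QM); apply: Qy.
  by rewrite /z exprS; ring.
exists (s ^+ l.+1), (k.+1 * l.+1)%N; split.
  by elim: l.+1 => [|j IHj]; [exact: prime_notin1|rewrite exprS;
    apply: prime_notinM].
by rewrite exprM -exprMn -[_ ^+ _]mul1r; apply: (ideal_pow_trans Qi QX Qb).
Qed.

Lemma set0_ideal : ideal [set (0 : R)].
Proof. by split=> // [x z -> ->|a x ->]; rewrite ?addr0 ?mulr0. Qed.

(* Kronecker's theorem, localised at a prime of height at most [d] *)
Lemma Kronecker d P (l : seq R) : prime_ideal P ->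
    ~ prime_chain [set 0] P d.+1 -> (forall e, e \in l -> P e) ->
  exists y, (forall i, P (y i)) /\
    forall e, e \in l -> loc_nilpotent P (span [set 0] d y) e.
Proof.
move=> pP nch; have [[P0 PD PM] P1 Pp] := pP.
elim: l => [|a l IH] Pl; first by exists (fun=> 0); split.
have [|y [Py yl]] := IH; first by move=> e el; apply: Pl; rewrite inE el orbT.
have Pa : P a by apply: Pl; rewrite mem_head.
have [x xa] := Kronecker_step set0_ideal pP nch y Pa.
(* The sequence is changed only by multiples of [a], which keeps the earlier elements under
   control. *)
exists (fun i => y i + a * x i); split=> [i|e].
  by apply: (PD) => //; rewrite mulrC; apply: (PM).
rewrite inE => /orP[/eqP->//|/yl[s [k [Ps [c ce]]]]].
case: xa => [t [j [Pt Qa]]].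
set y' := fun i : nat => _; pose Q := span [set 0] d y'.
have Qi : ideal Q by apply: span_ideal; exact: set0_ideal.
exists (t * s ^+ j), (k * j)%N; split.
  apply: prime_notinM => //.
  by elim: j {Qa} => [|j IHj] //; rewrite exprS; apply: prime_notinM.
rewrite exprM -mulrA -exprMn.
(* Modulo [Q], [s * e ^+ k] is [\sum c i * y i], hence [- a * \sum c i * x i], and [a] is already
   locally nilpotent modulo [Q]. *)
apply: (ideal_pow_trans (r := - \sum_(i < d) c i * x i) Qi _ Qa).
exists c; rewrite (_ : \sum_(i < d) c i * y' i =
  \sum_(i < d) c i * y i + a * \sum_(i < d) c i * x i).
  by rewrite mulrN opprK opprD addrA addrAC addrK.
by rewrite mulr_sumr -big_split; apply: eq_bigr => i _; rewrite /y' /=; ring.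
Qed.

End Ideals.

(** * Koszul complexes and their local homology *)

Section Koszul.
Variables (R : comPzRingType) (y : nat -> R).
Implicit Types U V W : lmodType R.

(* The Koszul complex of [y 0, ..., y n.-1] with coefficients in [V], as an *)
(* ungraded module: each step is the mapping cone of [y n].                 *)
Fixpoint koszul V n : lmodType R :=
  if n is m.+1 then (koszul V m * koszul V m)%type else V.

Fixpoint kdiff V n : koszul V n -> koszul V n :=
  match n with
  | 0 => fun=> 0
  | m.+1 => fun x => (kdiff x.1 + y m *: x.2, - kdiff x.2)
  end.

(** Homogeneity of degree [q]; the second summand of the cone is shifted by one. *)
Fixpoint kdeg V n (q : nat) : koszul V n -> Prop :=
  match n with
  | 0 => fun x => q = 0%N \/ x = 0
  | m.+1 => fun x => kdeg q x.1 /\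
                     (if q is p.+1 then kdeg p x.2 else x.2 = 0)
  end.

Fixpoint kmap U V (f : {linear U -> V}) n : koszul U n -> koszul V n :=
  match n with
  | 0 => f
  | m.+1 => fun x => (kmap f x.1, kmap f x.2)
  end.

Lemma kdiff_is_linear V n : linear (@kdiff V n).
Proof.
elim: n => [|n IH] a x z /=; first by rewrite scaler0 addr0.
rewrite !IH; congr pair; last by rewrite opprD -scalerN.
rewrite -[RHS]/(a *: (kdiff x.1 + y n *: x.2) + (kdiff z.1 + y n *: z.2)).
by rewrite !scalerDr !scalerA [y n * a]mulrC addrACA.
Qed.

HB.instance Definition _ V n :=
  GRing.isLinear.Build R (koszul V n) (koszul V n) _ _ (@kdiff_is_linear V n).

Lemma kmap_is_linear U V (f : {linear U -> V}) n : linear (@kmap U V f n).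
Proof.
by elim: n => [|n IH] a x z /=; [rewrite linearP|rewrite !IH].
Qed.

HB.instance Definition _ U V (f : {linear U -> V}) n :=
  GRing.isLinear.Build R (koszul U n) (koszul V n) _ _
    (@kmap_is_linear U V f n).

Lemma kdeg0 V n q : kdeg q (0 : koszul V n).
Proof. by elim: n q => [|n IH] [|q] /=; [left|right|split|split]. Qed.

Lemma kdegD V n q (x z : koszul V n) : kdeg q x -> kdeg q z -> kdeg q (x + z).
Proof.
elim: n q x z => [|n IH] q x z /=.
  by move=> [->|->]; [left|rewrite add0r].
move=> [x1 x2] [z1 z2]; split; first exact: IH.
by case: q x2 z2 {x1 z1} => [->->|q]; [rewrite addr0|exact: IH].
Qed.

Lemma kdegZ V n q a (x : koszul V n) : kdeg q x -> kdeg q (a *: x).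
Proof.
elim: n q x => [|n IH] q x /=.
  by move=> [->|->]; [left|rewrite scaler0; right].
move=> [x1 x2]; split; first exact: IH.
by case: q x2 {x1} => [->|q]; [rewrite scaler0|exact: IH].
Qed.

Lemma kdegN V n q (x : koszul V n) : kdeg q x -> kdeg q (- x).
Proof. by rewrite -scaleN1r; apply: kdegZ. Qed.

Lemma kdeg_sum V n q (T : finType) (F : T -> koszul V n) :
  (forall i, kdeg q (F i)) -> kdeg q (\sum_i F i).
Proof.
by move=> h; apply: (big_ind (kdeg q)) => //; [exact: kdeg0|exact: kdegD].
Qed.

Lemma kdeg_gt V n q (x : koszul V n) : (n < q)%N -> kdeg q x -> x = 0.
Proof.
elim: n q x => [|n IH] [|q] x //= lt_nq; first by case.
by case: x => x1 x2 /= [/(IH _ _ (ltnW lt_nq))-> /IH->].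
Qed.

Lemma kdiff_deg0 V n (x : koszul V n) : kdeg 0 x -> kdiff x = 0.
Proof.
by elim: n x => [|n IH] // [x1 x2] /= [/IH-> ->]; rewrite !linear0 addr0.
Qed.

Lemma kdeg_kdiff V n q (x : koszul V n) : kdeg q.+1 x -> kdeg q (kdiff x).
Proof.
elim: n q x => [|n IH] q x /=; first by right.
move=> [x1 x2]; split; first by apply: kdegD; [exact: IH|exact: kdegZ].
by case: q x2 {x1} => [|q] x2; [rewrite kdiff_deg0 ?oppr0|apply/kdegN/IH].
Qed.

Lemma kdeg_kmap U V (f : {linear U -> V}) n q (x : koszul U n) :
  kdeg q x -> kdeg q (kmap f x).
Proof.
elim: n q x => [|n IH] q x /=.
  by move=> [->|->]; [left|rewrite linear0; right].
move=> [x1 x2]; split; first exact: IH.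
by case: q x2 {x1} => [->|q]; [rewrite linear0|exact: IH].
Qed.

Lemma kdiffK V n (x : koszul V n) : kdiff (kdiff x) = 0.
Proof.
elim: n x => [|n IH] x //=.
by rewrite linearD linearZ !linearN /= linearN /= !IH !oppr0 add0r subrr.
Qed.

Lemma kmap_kdiff U V (f : {linear U -> V}) n (x : koszul U n) :
  kmap f (kdiff x) = kdiff (kmap f x).
Proof.
elim: n x => [|n IH] x /=; first by rewrite linear0.
by rewrite linearD linearZ linearN /= !IH.
Qed.

Lemma kmap_eq0 U V W (f : {linear U -> V}) (g : {linear V -> W}) n
    (x : koszul U n) :
  (forall v, g (f v) = 0) -> kmap g (kmap f x) = 0.
Proof. by move=> gf; elim: n x => [|n IH] x //=; rewrite !IH. Qed.

(** The Koszul complex is a finite power of its coefficients and [kmap] acts componentwise. *)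
Lemma kmap_exact U V W (f : {linear U -> V}) (g : {linear V -> W}) n q
    (x : koszul V n) :
  (forall v, g v = 0 -> exists u, f u = v) ->
  kdeg q x -> kmap g x = 0 -> exists u, kdeg q u /\ kmap f u = x.
Proof.
move=> fg; elim: n q x => [|n IH] q x /=.
  move=> [->|->] gx; last by exists 0; split; [right|rewrite linear0].
  by have [u <-] := fg _ gx; exists u; split=> //; left.
case: x => x1 x2 /= [d1 d2] [/(IH _ _ d1)[u1 [e1 <-]] g2].
suff [u2 [e2 <-]] : exists u2, (if q is p.+1 then kdeg p u2 else u2 = 0) /\
    kmap f u2 = x2 by exists (u1, u2).
case: q d2 {d1 e1} => [->|q /IH]; last exact.
by exists 0; rewrite linear0.
Qed.

(** Left exterior multiplication by [\sum c i * e_i], where a pair [x] stands for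
    [x.1 + e_m /\ x.2]. *)
Fixpoint khomotopy (c : nat -> R) V n : koszul V n -> koszul V n :=
  match n with
  | 0 => fun=> 0
  | m.+1 => fun x => (khomotopy c x.1, c m *: x.1 - khomotopy c x.2)
  end.

Lemma khomotopy_is_linear c V n : linear (@khomotopy c V n).
Proof.
elim: n => [|n IH] a x z /=; first by rewrite scaler0 addr0.
rewrite !IH; congr pair.
rewrite -[RHS]/(a *: (c n *: x.1 - khomotopy c x.2)
                 + (c n *: z.1 - khomotopy c z.2)).
by rewrite !scalerDr !scalerA scalerN [c n * a]mulrC opprD addrACA.
Qed.

HB.instance Definition _ c V n :=
  GRing.isLinear.Build R (koszul V n) (koszul V n) _ _
    (@khomotopy_is_linear c V n).

Lemma kdeg_khomotopy c V n q (x : koszul V n) :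
  kdeg q x -> kdeg q.+1 (khomotopy c x).
Proof.
elim: n q x => [|n IH] q x /=; first by right.
move=> [x1 x2]; split; first exact: IH.
apply: kdegD; first exact: kdegZ.
apply: kdegN; case: q x2 {x1} => [->|q]; last exact: IH.
by rewrite linear0; exact: kdeg0.
Qed.

(** Multiplication by an element of the ideal of the [y i] is null-homotopic, so this ideal kills
    the Koszul homology. *)
Lemma khomotopyP c V n (x : koszul V n) :
  kdiff (khomotopy c x) + khomotopy c (kdiff x) =
  (\sum_(i < n) c i * y i) *: x.
Proof.
elim: n x => [|n IH] x /=; first by rewrite addr0 big_ord0 scale0r.
rewrite big_ord_recr /=; set S := \sum_(i < n) _; case: x => x1 x2 /=.
rewrite -[RHS]/((S + c n * y n) *: x1, (S + c n * y n) *: x2).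
rewrite !scalerDl -!IH; congr pair => /=.
  rewrite [khomotopy c (_ + _)]linearD linearZ /= scalerBr scalerA.
  by rewrite [y n * c n]mulrC addrACA subrK.
rewrite [kdiff (_ - _)]linearB linearZ [khomotopy c (- _)]linearN /=.
rewrite opprB opprK.
by rewrite scalerDr scalerA -[_ + _ + khomotopy c _]addrA subrKA -addrA
  [_ *: x2 + _]addrC.
Qed.

End Koszul.

(** * Functoriality of the Koszul complex and dual bases *)

Section KoszulMaps.
Variable R : comPzRingType.
Implicit Types U V W : lmodType R.

Definition line V (v : V) : R^o -> V := fun r => r *: v.

Lemma line_is_linear V (v : V) : linear (line v).
Proof. by move=> a r s; rewrite /line scalerDl scalerA. Qed.

HB.instance Definition _ V (v : V) :=
  GRing.isLinear.Build R R^o V _ (line v) (line_is_linear v).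

Lemma kmapA U V W (f : {linear U -> V}) (g : {linear V -> W}) n
    (x : koszul U n) :
  kmap g (kmap f x) = kmap (g \o f) x.
Proof. by elim: n x => [|n IH] x //=; rewrite !IH. Qed.

Lemma kmap_scale V (h : {linear V -> V}) a n (x : koszul V n) :
  (forall v, h v = a *: v) -> kmap h x = a *: x.
Proof. by move=> ha; elim: n x => [|n IH] x //=; rewrite !IH. Qed.

Lemma kmap_id V n (x : koszul V n) : kmap (idfun : {linear V -> V}) x = x.
Proof. by rewrite (@kmap_scale _ _ 1) ?scale1r // => v; rewrite scale1r. Qed.

Lemma kmap_sum U V (T : finType) (h : {linear U -> V})
    (f : T -> {linear U -> V}) n (x : koszul U n) :
  (forall u, h u = \sum_i f i u) -> kmap h x = \sum_i kmap (f i) x.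
Proof.
move=> hf; elim: n x => [|n IH] x //=; rewrite !IH.
by rewrite [RHS]surjective_pairing (big_morph fst (id1 := 0) (op1 := +%R)) //
  (big_morph snd (id1 := 0) (op1 := +%R)).
Qed.

Definition dual_basis V m (g : 'I_m -> V) (f : 'I_m -> {linear V -> R^o}) :=
  forall x, x = \sum_i f i x *: g i.

Lemma kmap_dual_basis V m (g : 'I_m -> V) (f : 'I_m -> {linear V -> R^o}) n
    (x : koszul V n) : dual_basis g f ->
  x = \sum_i kmap (line (g i)) (kmap (f i) x).
Proof.
move=> gf; rewrite -[LHS](kmap_id x).
under eq_bigr do rewrite kmapA.
exact: kmap_sum.
Qed.

(** The generators give a surjection from [R^m]; the [f i] are the coordinates of a section of
    it. *)
Lemma projective_dual_basis V : finitely_generated V -> projective V ->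
  exists m g f, @dual_basis V m g f.
Proof.
move=> [m [g gV]] pV.
pose lc (v : 'rV[R]_m) : V := \sum_i v 0 i *: g i.
have lc_lin : linear lc.
  move=> a u v; rewrite /lc scaler_sumr -big_split; apply: eq_bigr => i _ /=.
  by rewrite !mxE scalerDl scalerA.
pose lcL : {linear 'rV[R]_m -> V} :=
  HB.pack lc (GRing.isLinear.Build R _ _ _ lc lc_lin).
have [y|h hK] := pV _ _ lcL [the {linear V -> V} of idfun].
  by have [a ->] := gV y; exists (\row_i a i);
    apply: eq_bigr => i _; rewrite mxE.
pose f i (x : V) : R^o := h x 0 i.
have f_lin i : linear (f i) by move=> a u v; rewrite /f linearP !mxE.
exists m, g, (fun i => HB.pack_for {linear V -> R^o} (f i)
  (GRing.isLinear.Build R V R^o _ (f i) (f_lin i))).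
by move=> x; rewrite -[LHS]/(idfun x) -hK.
Qed.

End KoszulMaps.

(** * Koszul homology localised at a prime *)

Section LocalHomology.
Variables (R : comPzRingType) (P : set R) (y : nat -> R) (n : nat).
Hypothesis pP : prime_ideal P.
Implicit Types U V W : lmodType R.

(** For a cycle [x], its class vanishes in the homology localised at [P]; the denominator [s]
    replaces the localisation. *)
Definition loc_bound V q (x : koszul V n) :=
  exists s u, [/\ ~ P s, kdeg q.+1 u & kdiff y u = s *: x].

Definition loc_acyclic V q :=
  forall x : koszul V n, kdeg q x -> kdiff y x = 0 -> loc_bound q x.

Lemma loc_bound0 V q : loc_bound q (0 : koszul V n).
Proof.
exists 1, 0; split; [exact: prime_notin1|exact: kdeg0|].
by rewrite linear0 scaler0.
Qed.

Lemma loc_boundD V q (x z : koszul V n) :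
  loc_bound q x -> loc_bound q z -> loc_bound q (x + z).
Proof.
move=> [s [u [Ps du us]]] [t [v [Pt dv vt]]].
exists (s * t), (t *: u + s *: v); split; first exact: prime_notinM.
  by apply: kdegD; apply: kdegZ.
by rewrite linearD !linearZ /= us vt scalerDr !scalerA [t * s]mulrC.
Qed.

Lemma loc_boundZ V q a (x : koszul V n) : loc_bound q x -> loc_bound q (a *: x).
Proof.
move=> [s [u [Ps du us]]]; exists s, (a *: u); split=> //; first exact: kdegZ.
by rewrite linearZ /= us !scalerA mulrC.
Qed.

Lemma loc_bound_unit V q s (x : koszul V n) :
  ~ P s -> loc_bound q (s *: x) -> loc_bound q x.
Proof.
move=> Ps [t [u [Pt du ut]]]; exists (t * s), u; split=> //.
  exact: prime_notinM.
by rewrite ut scalerA.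
Qed.

Lemma loc_bound_sum V q (T : finType) (F : T -> koszul V n) :
  (forall i, loc_bound q (F i)) -> loc_bound q (\sum_i F i).
Proof.
by move=> h; apply: (big_ind (loc_bound q)) => //;
  [exact: loc_bound0|exact: loc_boundD].
Qed.

Lemma loc_bound_kmap U V (f : {linear U -> V}) q (x : koszul U n) :
  loc_bound q x -> loc_bound q (kmap f x).
Proof.
move=> [s [u [Ps du us]]]; exists s, (kmap f u); split=> //.
  exact: kdeg_kmap.
by rewrite -kmap_kdiff us linearZ.
Qed.

(** [V] is a direct summand of [R^m], and homology is additive. *)
Lemma loc_acyclic_projective V m (g : 'I_m -> V) f q :
  dual_basis g f -> loc_acyclic R^o q -> loc_acyclic V q.
Proof.
move=> gf acR x dx x0; rewrite (kmap_dual_basis x gf).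
apply: loc_bound_sum => i; apply/loc_bound_kmap/acR; first exact: kdeg_kmap.
by rewrite -kmap_kdiff x0 linear0.
Qed.

Lemma loc_acyclic_gt V q : (n < q)%N -> loc_acyclic V q.
Proof. by move=> nq x /(kdeg_gt nq)-> _; exact: loc_bound0. Qed.

Lemma span_loc_bound V q (x : koszul V n) r : span [set 0] n y r ->
  kdeg q x -> kdiff y x = 0 -> loc_bound q (r *: x).
Proof.
move=> [c /eqP]; rewrite subr_eq0 => /eqP-> dx x0.
exists 1, (khomotopy c x); split; first exact: prime_notin1.
  exact: kdeg_khomotopy.
by rewrite -khomotopyP x0 linear0 addr0 scale1r.
Qed.

Section Chase.
Variables (F : nat -> lmodType R) (d : forall i, {linear F i.+1 -> F i}).
Hypothesis d_exact : forall i x, d i x = 0 <-> exists z, d i.+1 z = x.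

(** A staircase in the double complex: each step lowers the index of [F] and raises the Koszul
    degree, which exceeds [n] by the time [F 0] is reached. *)
Lemma loc_chase i q (w : koszul (F i.+1) n) (w' : koszul (F i) n) :
    (forall q' j, (q < q')%N -> loc_acyclic (F j) q') ->
    (n < q + i.+1)%N -> kdeg q w -> kdeg q.+1 w' ->
    kmap (d i) w = kdiff y w' ->
  exists s v t, [/\ ~ P s, kdeg q.+1 v, kdeg q t &
    s *: w = kdiff y v + kmap (d i.+1) t].
Proof.
elim: i q w w' => [|i IH] q w w' acF nq dw dw' ww'.
  have [|//||t [dt tw]] := @kmap_exact _ _ _ _ (d 1%N) (d 0%N) n q w.
  - by move=> v /d_exact.
  (* Here [w'] has degree above [n], hence vanishes. *)
  - by rewrite addn1 in nq; rewrite ww' (kdeg_gt nq dw') linear0.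
  exists 1, 0, t; split=> //; first exact: prime_notin1.
    exact: kdeg0.
  by rewrite linear0 add0r scale1r.
have ddE (v : F i.+2) : d i (d i.+1 v) = 0 by apply/d_exact; exists v.
(* The image of [w'] is a cycle, locally the boundary of some [w'']. The next stair then corrects
   [w] by a boundary so that [d i.+1] kills it. *)
have [|||s [w'' [Ps dw'' w''E]]] := acF q.+1 i _ (kmap (d i) w') => //.
- exact: kdeg_kmap.
- by rewrite -kmap_kdiff -ww' (kmap_eq0 _ ddE).
have [|||||t [u [v [Pt du dv uv]]]] := IH q.+1 (s *: w') w'' => //.
- by move=> q' j /ltnW; exact: acF.
- by rewrite addSnnS.
- exact: kdegZ.
- by rewrite linearZ w''E.
have [|||r [dr rE]] := @kmap_exact _ _ _ _ (d i.+2) (d i.+1) n q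
    ((t * s) *: w - kdiff y v).
- by move=> x /d_exact.
- apply: kdegD; first exact: kdegZ.
  by apply: kdegN; exact: kdeg_kdiff.
- rewrite linearB linearZ /= ww' kmap_kdiff -scalerA -[s *: _]linearZ /=.
  by rewrite -linearZ /= uv linearD /= kdiffK add0r subrr.
exists (t * s), v, r; split=> //; first exact: prime_notinM.
by rewrite rE addrC subrK.
Qed.

End Chase.

End LocalHomology.

(** * McCoy's theorem *)

Section McCoy.
Variables (R : comPzRingType) (M : lmodType R) (Z B : M -> Prop).
Hypothesis ZZ : forall a z, Z z -> Z (a *: z).
Hypothesis BZ : forall a z, B z -> B (a *: z).

(** [Z] and [B] stand for cycles and boundaries. For each [e] in turn, the last power not sending
    [z] into [B] would lead to an element outside [B] that all of [l] sends into [B]. *)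
Lemma nilpotent_descent (l : seq R) :
    (forall e z, e \in l -> Z z -> exists k, B (e ^+ k *: z)) ->
    (forall z, Z z -> (forall e, e \in l -> B (e *: z)) -> B z) ->
  forall z, Z z -> B z.
Proof.
elim: l => [|e l IH] nil reg z Zz; first exact: reg.
apply: IH Zz => [e' x e'l|{}z Zz lz].
  by apply: nil; rewrite inE e'l orbT.
have [k] := nil e z (mem_head _ _) Zz.
elim: k => [|k IHk]; first by rewrite scale1r.
move=> Bk; apply/IHk/reg => [|e']; first exact: ZZ.
rewrite inE => /orP[/eqP->|/lz]; first by rewrite scalerA -exprS.
by rewrite scalerA mulrC -scalerA; exact: BZ.
Qed.

Variables (T : Type) (m : nat) (A : T -> 'I_m -> R).

Definition minor r (f : 'I_r -> T) (g : 'I_r -> 'I_m) : R :=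
  \det (\matrix_(i, j) A (f i) (g j)).

Hypothesis A_inj : forall v : 'I_m -> M, (forall i, Z (v i)) ->
  (forall t, B (\sum_i A t i *: v i)) -> forall i, B (v i).

Lemma McCoy_step r z : (r < m)%N -> Z z ->
    (forall f g, B (@minor r.+1 f g *: z)) ->
  forall f g, B (@minor r f g *: z).
Proof.
move=> rm Zz Br f g.
have [c cg] : exists c, forall k, g k != c.
  apply: contrapT => nc.
  have sur c : c \in codom g.
    apply: contrapT => cg; apply: nc; exists c => k.
    by apply/eqP => gk; apply: cg; rewrite -gk codom_f.
  have : (m <= r)%N.
    rewrite -[X in (X <= _)%N]card_ord -[X in (_ <= X)%N]card_ord.
    rewrite -(size_codom g).
    have <- : #|codom g| = #|'I_m| by apply: eq_card => i; rewrite sur.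
    exact: card_size.
  by rewrite leqNgt rm.
pose g' k := oapp g c (unlift (ord0 : 'I_r.+1) k).
pose f' t k := oapp f t (unlift (ord0 : 'I_r.+1) k).
pose D t : 'M[R]_r.+1 := \matrix_(i, j) A (f' t i) (g' j).
(* The cofactors along the first row do not depend on that row. *)
pose cof (j : 'I_r.+1) : R :=
  (-1) ^+ (0 + j) * \det (\matrix_(i, k) A (f i) (g' (lift j k))).
have cofE t j : cofactor (D t) ord0 j = cof j.
  congr (_ * \det _); apply/matrixP => i k.
  by rewrite !mxE /f' liftK.
have cof0 : cof ord0 = minor f g.
  rewrite /cof mul1r; congr (\det _); apply/matrixP => i k.
  by rewrite !mxE /g' liftK.
(* Columns may repeat in [g'], hence the sum; only [ord0] is sent to [c]. *)
pose v i := \sum_(j | g' j == i) cof j *: z.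
have -> : minor f g *: z = v c.
  rewrite /v (bigD1 ord0) /=; last by rewrite /g' unlift_none.
  rewrite cof0 big1 ?addr0 // => j /andP[+ j0].
  by case: (unliftP ord0 j) j0 => [k ->|->]; rewrite ?eqxx // /g' liftK /=
    (negPf (cg k)).
apply: A_inj => [i|t].
  by rewrite /v -scaler_suml; exact: ZZ.
rewrite (_ : \sum_i _ = minor (f' t) g' *: z); first exact: Br.
rewrite /minor (expand_det_row _ ord0) scaler_suml.
rewrite /v (partition_big g' xpredT) //=.
apply: eq_bigr => i _; rewrite scaler_sumr; apply: eq_bigr => j /eqP gj.
by rewrite cofE mxE /f' unlift_none /= gj scalerA.
Qed.

Lemma minor_cols (f : 'I_m -> T) (g : 'I_m -> 'I_m) :
  minor f g = minor f id * \det (\matrix_(i, j) (i == g j)%:R : 'M[R]_m).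
Proof.
rewrite -det_mulmx; congr (\det _); apply/matrixP => i j; rewrite !mxE.
rewrite (bigD1 (g j)) //= !mxE eqxx mulr1 big1 ?addr0 // => k /negPf kg.
by rewrite !mxE kg mulr0.
Qed.

Lemma McCoy z : Z z -> (forall f, B (minor f id *: z)) -> B z.
Proof.
move=> Zz Bm.
(* The size descends from [m] to 0, where the minor is 1. *)
suff H k : (k <= m)%N -> forall f g, B (@minor (m - k) f g *: z).
  have [t|] := pselect (inhabited ('I_(m - m) -> T)).
    case: t => t.
    have g : 'I_(m - m) -> 'I_m by rewrite subnn => -[].
    have := H m (leqnn _) t g; rewrite /minor.
    by move: (\matrix_(i, j) _); rewrite subnn => N; rewrite det_mx00 scale1r.
  by case; constructor; rewrite subnn => -[].
elim: k => [_ f g|k IH km f g].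
  by move: f g; rewrite subn0 => f g; rewrite minor_cols mulrC -scalerA;
    exact: BZ.
apply: McCoy_step => //; first by rewrite ltn_subrL (leq_ltn_trans _ km).
by rewrite subnSK //; exact/IH/ltnW.
Qed.

End McCoy.

(** * Splitting the leftmost map *)

Section Splitting.
Variable R : comPzRingType.
Implicit Types V W : lmodType R.

Fixpoint kone n : koszul R^o n :=
  if n is m.+1 then (kone m, 0) else (1 : R^o).

Fixpoint kbot n : koszul R^o n -> R :=
  if n is m.+1 then fun x => kbot x.1 else id.

Lemma kdeg_kone n : kdeg 0 (kone n).
Proof. by elim: n => [|n IH] /=; [left|split]. Qed.

Lemma kbotZ_kone n a : kbot (a *: kone n) = a.
Proof. by elim: n => [|n IH] //=; rewrite [LHS]mulr1. Qed.

(** The degree 0 part of a boundary is a combination of the [y i]; so the degree 0 homology at [P]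
    is nonzero. *)
Lemma kbot_kdiff P y n (x : koszul R^o n) :
  ideal P -> (forall i, P (y i)) -> P (kbot (kdiff y x)).
Proof.
move=> [P0 PD PM] Py.
have kbotD m (u v : koszul R^o m) : kbot (u + v) = kbot u + kbot v.
  by elim: m u v => [|m IH] u v //=; rewrite IH.
have kbotZ m a (v : koszul R^o m) : kbot (a *: v) = a * kbot v.
  by elim: m v => [|m IH] v //=; rewrite IH.
elim: n x => [|n IH] x //=; rewrite kbotD kbotZ; apply: (PD) => //.
by rewrite mulrC; apply: (PM).
Qed.

Definition left_inverse_up_to V W (phi : {linear V -> W}) : set R :=
  [set r | exists psi : {linear W -> V}, forall x, psi (phi x) = r *: x].

Lemma left_inverse_up_to_ideal V W (phi : {linear V -> W}) :
  ideal (left_inverse_up_to phi).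
Proof.
split.
- by exists [the {linear W -> V} of \0] => x; rewrite scale0r.
- move=> r s [f fr] [g gs]; exists [the {linear W -> V} of f \+ g] => x.
  by rewrite /= fr gs scalerDl.
- move=> a r [f fr]; exists [the {linear W -> V} of a \*: f] => x.
  by rewrite /= fr scalerA.
Qed.

Section Presentation.
Variables (V W : lmodType R) (phi : {linear V -> W}).
Variables (m p : nat) (g : 'I_m -> V) (f : 'I_m -> {linear V -> R^o}).
Variables (h : 'I_p -> W) (k : 'I_p -> {linear W -> R^o}).
Hypotheses (gf : dual_basis g f) (hk : dual_basis h k).

(* The dual bases exhibit [V] and [W] as direct summands of [R^m] and [R^p]; *)
(* this is the matrix of the sum of [phi] and the identity of the complement *)
(* of [V], so that its kernel is that of [phi].                              *)
Definition stable_matrix (t : 'I_p + 'I_m) (j : 'I_m) : R :=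
  match t with
  | inl a => k a (phi (g j))
  | inr b => (b == j)%:R - f b (g j)
  end.

(** The second block projects onto the complement of [V] in [R^m], so it kills the coordinates of
    [x]. *)
Lemma stable_matrix_phi t x :
  (if t is inl a then k a (phi x) else 0) = \sum_j stable_matrix t j * f j x.
Proof.
case: t => [a|b] /=.
  rewrite [in LHS](gf x) !linear_sum; apply: eq_bigr => j _.
  by rewrite !linearZ; exact: mulrC.
under eq_bigr do rewrite mulrBl; rewrite sumrB (bigD1 b) //= eqxx mul1r.
rewrite big1 ?addr0 => [|j /negPf jb]; last by rewrite eq_sym jb mul0r.
rewrite [in f b x](gf x) linear_sum -sumrB big1 // => j _.
by apply/eqP; rewrite subr_eq0 linearZ; apply/eqP; exact: mulrC.
Qed.

(** Cramer's rule: the adjugate of the chosen rows inverts them up to the minor. Rows of the second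
    block vanish on [V], so [kap] may be 0 there. *)
Lemma stable_minor (s : 'I_m -> 'I_p + 'I_m) :
  left_inverse_up_to phi (minor stable_matrix s id).
Proof.
pose N : 'M[R]_m := \matrix_(i, j) stable_matrix (s i) j.
pose kap l (x : W) : R := if s l is inl a then k a x else 0.
pose psi x := \sum_j (\sum_l (\adj N) j l * kap l x) *: g j.
have psi_lin : linear psi.
  move=> a x z; rewrite /psi scaler_sumr -big_split; apply: eq_bigr => j _ /=.
  rewrite scalerA -scalerDl; congr (_ *: _).
  rewrite mulr_sumr -big_split; apply: eq_bigr => l _ /=.
  rewrite /kap; case: (s l) => [b|b]; last by rewrite !mulr0 addr0.
  by rewrite linearP mulrDr mulrCA.
exists (HB.pack_for {linear W -> V} psi
          (GRing.isLinear.Build R W V _ psi psi_lin)) => x /=.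
rewrite [in RHS](gf x) scaler_sumr; apply: eq_bigr => j _.
rewrite scalerA; congr (_ *: _).
have kapE l : kap l (phi x) = \sum_i N l i * f i x.
  by rewrite /kap stable_matrix_phi; apply: eq_bigr => i _; rewrite mxE.
under eq_bigr do rewrite kapE mulr_sumr.
rewrite exchange_big /=.
under eq_bigr => i _.
  under eq_bigr do rewrite mulrA.
  rewrite -mulr_suml (_ : \sum_l _ = (\adj N *m N) j i); last by rewrite mxE.
  rewrite mul_adj_mx mxE.
  over.
rewrite (bigD1 j) //= eqxx mulr1n big1 ?addr0 // => i /negPf ij.
by rewrite eq_sym ij mulr0n mul0r.
Qed.

Variables (P : set R) (y : nat -> R) (n q : nat).
Hypothesis pP : prime_ideal P.

(* Injectivity of [phi] on the [q]-th Koszul homology, localised at [P]. *)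
Definition loc_inj : Prop := forall w : koszul V n,
  kdeg q w -> kdiff y w = 0 -> loc_bound P y q (kmap phi w) ->
  loc_bound P y q w.

(** The first block bounds the image under [phi] of the projection [w] of [v], hence [w] itself; the
    second block bounds the component of [v] in the complement. *)
Lemma stable_matrix_inj : loc_inj -> forall v : 'I_m -> koszul R^o n,
    (forall i, kdeg q (v i) /\ kdiff y (v i) = 0) ->
    (forall t, loc_bound P y q (\sum_i stable_matrix t i *: v i)) ->
  forall i, loc_bound P y q (v i).
Proof.
move=> phi_inj v Zv Bv i.
pose w : koszul V n := \sum_j kmap (line (g j)) (v j).
have kmap_w (c : {linear V -> R^o}) : kmap c w = \sum_j c (g j) *: v j.
  rewrite /w linear_sum; apply: eq_bigr => j _ /=.
  rewrite kmapA; apply: kmap_scale => r /=.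
  by rewrite /line linearZ; exact: mulrC.
have : loc_bound P y q w.
  apply: phi_inj.
  - by apply: kdeg_sum => j; apply: kdeg_kmap; case: (Zv j).
  - rewrite /w linear_sum big1 // => j _ /=.
    by rewrite -kmap_kdiff; case: (Zv j) => _ ->; rewrite linear0.
  - rewrite (kmap_dual_basis (kmap phi w) hk).
    apply: loc_bound_sum => // a; apply: loc_bound_kmap.
    by rewrite kmapA kmap_w; apply: (Bv (inl a)).
move=> /(loc_bound_kmap (f i)); rewrite kmap_w // => fw.
rewrite (_ : v i = (\sum_j stable_matrix (inr i) j *: v j)
                   + \sum_j f i (g j) *: v j); first exact: loc_boundD.
rewrite -big_split (bigD1 i) //= big1 => [|j /negPf ji].
  by rewrite eqxx addr0 -scalerDl subrK scale1r.
by rewrite eq_sym ji -scalerDl subrK scale0r.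
Qed.

End Presentation.

Section Top.
Variables (F : nat -> lmodType R) (d : forall i, {linear F i.+1 -> F i}).
Hypothesis d_exact : forall i x, d i x = 0 <-> exists z, d i.+1 z = x.
Hypothesis F_fg : forall i, finitely_generated (F i).
Hypothesis F_proj : forall i, projective (F i).

Lemma loc_inj_top P y n q i : prime_ideal P -> zero_module (F i.+2) ->
    (n < q + i.+1)%N ->
    (forall q' j, (q < q')%N -> loc_acyclic P y n (F j) q') ->
  loc_inj (d i) P y n q.
Proof.
move=> pP F0 nq acF w dw w0 [s [w' [Ps dw' w'E]]].
have [||t [v [u [Pt dv du uv]]]] :=
    loc_chase pP d_exact (w := s *: w) (w' := w') acF nq _ dw'.
- exact: kdegZ.
- by rewrite linearZ w'E.
have d0 (x : F i.+2) : d i.+1 x = 0 by rewrite (F0 x) linear0.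
exists (t * s), v; split=> //; first exact: prime_notinM.
(* The zero map [d i.+1] is written as an empty sum, so that its [kmap] vanishes. *)
rewrite -scalerA uv (kmap_sum (f := fun _ : 'I_0 => d i.+1)) => [|x].
  by rewrite big_ord0 addr0.
by rewrite big_ord0 d0.
Qed.

Lemma split_top n i : (n <= i)%N -> zero_module (F i.+2) ->
    (forall P, prime_ideal P -> ~ prime_chain [set (0 : R)] P n.+1) ->
  exists psi : {linear F i -> F i.+1}, forall x, psi (d i x) = x.
Proof.
move=> ni F0 ht; set E := left_inverse_up_to (d i).
have Ei : ideal E by exact: left_inverse_up_to_ideal.
suff [psi psiK] : E 1 by exists psi => x; rewrite psiK scale1r.
apply: contrapT => nE1.
have [|||P [pP EP _]] := @exists_prime _ E [set 1] Ei.
- by [].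
- by move=> x z -> ->; rewrite mulr1.
- by move=> x Ex x1; apply: nE1; rewrite -x1.
have [Pi P1 _] := pP.
have [m [g [f gf]]] := projective_dual_basis (F_fg i.+1) (@F_proj i.+1).
have [p [h [k hk]]] := projective_dual_basis (F_fg i) (@F_proj i).
pose A := stable_matrix (d i) g f k.
pose l := [seq minor A s id | s : {ffun 'I_m -> 'I_p + 'I_m}].
have lP e : e \in l -> P e.
  by move=> /mapP[s _ ->]; apply/EP/stable_minor.
have [y [Py ly]] := Kronecker pP (ht _ pP) lP.
(* Descending induction on [q], as induction on [N]; it starts above the top degree [n]. *)
have ac N q : (n < q + N)%N -> loc_acyclic P y n R^o q.
  elim: N q => [|N IH] q; first by rewrite addn0; exact: loc_acyclic_gt.
  move=> nq; have acF q' j : (q < q')%N -> loc_acyclic P y n (F j) q'.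
    move=> qq'; have [m' [g' [f' gf']]] :=
      projective_dual_basis (F_fg j) (@F_proj j).
    apply: (loc_acyclic_projective pP gf'); apply: IH.
    by apply: leq_trans nq _; rewrite addnS -addSn leq_add2r.
  have phi_inj : loc_inj (d i) P y n q.
    by apply: loc_inj_top => //; rewrite ltn_addl.
  move=> z dz z0.
  have BZ := @loc_boundZ _ P y n R^o q.
  pose Z (x : koszul R^o n) := kdeg q x /\ kdiff y x = 0.
  have ZZ a x : Z x -> Z (a *: x).
    by move=> [dx x0]; split; [exact: kdegZ|rewrite linearZ /= x0 scaler0].
  apply: (@nilpotent_descent _ _ Z (loc_bound P y q) ZZ BZ l _ _ z).
  - move=> e x /ly[s [j [Ps es]]] [dx x0]; exists j.
    apply: (loc_bound_unit pP Ps); rewrite scalerA.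
    exact: span_loc_bound.
  - move=> x Zx lx; apply: (McCoy ZZ BZ (A := A) _ Zx).
      exact: stable_matrix_inj.
    move=> s; apply: lx; apply/mapP; exists (finfun s); rewrite ?mem_enum //.
    by congr (\det _); apply/matrixP => a b; rewrite !mxE ffunE.
  - by [].
(* In degree 0, some [s] outside [P] times the unit is a boundary, yet its bottom coordinate [s]
   must lie in [P]. *)
have [||s [u [Ps _ us]]] := ac n.+1 0%N _ (kone n) (kdeg_kone n).
- by rewrite add0n.
- by rewrite kdiff_deg0 //; exact: kdeg_kone.
apply: Ps; rewrite -[s](kbotZ_kone n) -us; exact: kbot_kdiff.
Qed.

End Top.

End Splitting.

(** * Shortening resolutions *)

Section Kernel.
Variables (R : comPzRingType) (V W : lmodType R) (f : {linear V -> W}).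

Definition ker_pred : {pred V} := fun x => f x == 0.

Lemma ker_submod_closed : submod_closed ker_pred.
Proof.
split=> [|a x z /eqP fx /eqP fz]; first by apply/eqP; rewrite linear0.
by apply/eqP; rewrite linearP fx fz scaler0 addr0.
Qed.

HB.instance Definition _ :=
  GRing.isSubmodClosed.Build R V ker_pred ker_submod_closed.

Record kernel := Kernel { kerval : V; _ : kerval \in ker_pred }.

HB.instance Definition _ := [isSub for kerval].
HB.instance Definition _ := [Choice of kernel by <:].
HB.instance Definition _ := [SubChoice_isSubLmodule of kernel by <:].

Lemma kervalP (x : kernel) : f (kerval x) = 0.
Proof. by apply/eqP; apply: (valP x). Qed.

Lemma kervalE v : f v = 0 <-> exists x, kerval x = v.
Proof.
split=> [/eqP fv|[x <-]]; last exact: kervalP.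
by exists (Kernel (fv : v \in ker_pred)).
Qed.

Variables (U : lmodType R) (h : {linear U -> V}).
Hypothesis fh : forall u, f (h u) = 0.

Definition to_kernel (u : U) : kernel := Kernel (introT eqP (fh u)).

Lemma to_kernel_is_linear : linear to_kernel.
Proof. by move=> a u v; apply: val_inj; rewrite /= linearP. Qed.

HB.instance Definition _ :=
  GRing.isLinear.Build R U kernel _ to_kernel to_kernel_is_linear.

End Kernel.

Section Resolutions.
Variable R : comPzRingType.
Implicit Types M K V : lmodType R.

Definition fg_projective V := finitely_generated V /\ projective V.

(** The resolution of [K] is spliced with [K -> V -> M] through [iota \o e']. *)
Lemma has_resolution_cons (C : lmodType R -> Prop) M K V
    (e : {linear V -> M}) (iota : {linear K -> V}) n :
    C V -> (forall z, exists x, e x = z) -> injective iota ->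
    (forall x, e x = 0 <-> exists z, iota z = x) ->
  has_resolution C K n -> has_resolution C M n.+1.
Proof.
move=> CV e_surj iota_inj e_ker [P [d [e' [CP P0 e'_surj e'_ker d_ker]]]].
pose P' i := if i is j.+1 then P j else V.
pose d' i : {linear P' i.+1 -> P' i} :=
  if i is j.+1 return {linear P' i.+1 -> P' i} then d j else iota \o e'.
exists P', d', e; split=> //.
- by case.
- by case=> // i /P0.
- move=> x; rewrite e_ker; split=> [[z <-]|[z <-]]; last by exists (e' z).
  by have [w <-] := e'_surj z; exists w.
- case=> [|i] x /=; last exact: d_ker.
  rewrite -e'_ker; split=> [|->]; last by rewrite linear0.
  by rewrite -[RHS](linear0 iota) => /iota_inj.
Qed.

Lemma has_resolution0 (C : lmodType R -> Prop) M :
  C ('rV[R]_0 : lmodType R) -> C M -> has_resolution C M 0.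
Proof.
move=> C0 CM; pose P i : lmodType R := if i is 0 then M else 'rV[R]_0.
have P0 i : zero_module (P i.+1) by move=> x; exact: thinmx0.
exists P, (fun i => [the {linear P i.+1 -> P i} of \0]),
  [the {linear M -> M} of idfun]; split=> //=.
- by case.
- by case.
- by move=> z; exists z.
- by move=> x; split=> [->|[z <-] //]; exists 0.
- by move=> i x; split=> [_|//]; exists 0; rewrite (P0 i x).
Qed.

Lemma fg_projective0 : fg_projective 'rV[R]_0.
Proof.
split; first by exists 0%N, (fun=> 0) => x; exists (fun=> 0);
  rewrite big_ord0 thinmx0.
move=> N N' g f _; exists [the {linear 'rV[R]_0 -> N} of \0] => x.
by rewrite /= linear0 [x]thinmx0 linear0.
Qed.

Lemma fg_projective_retract V M (e : {linear V -> M}) (s : {linear M -> V}) :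
  (forall x, e (s x) = x) -> fg_projective V -> fg_projective M.
Proof.
move=> es [[n [g gV]] pV]; split.
  exists n, (fun i => e (g i)) => x; have [a ax] := gV (s x); exists a.
  rewrite -[LHS]es ax linear_sum; apply: eq_bigr => i _.
  by rewrite linearZ.
move=> N N' q f q_surj; have [h hK] := pV _ _ q (f \o e) q_surj.
by exists (h \o s) => x; rewrite /= hK /= es.
Qed.

(** The map [tau = id - d psi] kills the image of [d], which is the kernel of [e], so it factors
    through [M] as a section of [e]. *)
Lemma split_retract U V M (d : {linear U -> V}) (e : {linear V -> M})
    (psi : {linear V -> U}) :
    (forall z, exists x, e x = z) ->
    (forall x, e x = 0 <-> exists z, d z = x) ->
    (forall x, psi (d x) = x) ->
  exists s : {linear M -> V}, forall x, e (s x) = x.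
Proof.
move=> e_surj e_ker psiK.
pose tau x := x - d (psi x).
have tauP a x z : tau (a *: x + z) = a *: tau x + tau z.
  by rewrite /tau [psi _]linearP [d _]linearP scalerBr opprD addrACA.
have tau_wd x x' : e x = e x' -> tau x = tau x'.
  move=> exx'; have [w wE] : exists w, d w = x - x' by apply/e_ker;
    rewrite linearB exx' subrr.
  apply/eqP; rewrite -subr_eq0 addrC -scaleN1r -tauP scaleN1r addrC -wE.
  by rewrite /tau psiK subrr.
have [rep repK] : exists rep, forall z, e (rep z) = z.
  by have [rep] := choice e_surj; exists rep.
have s_lin : linear (tau \o rep).
  move=> a x z /=; rewrite -tauP; apply: tau_wd.
  by rewrite linearP !repK.
exists (HB.pack_for {linear M -> V} (tau \o rep)
          (GRing.isLinear.Build R M V _ (tau \o rep) s_lin)) => x /=.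
rewrite /tau linearB /= repK (_ : e (d _) = 0) ?subr0 //.
by apply/e_ker; eexists.
Qed.

(** For [n = 0], [M] is a retract of [P 0]; otherwise pass to the kernel of [e], resolved by the
    shifted sequence. *)
Lemma shorten_resolution n M (P : nat -> lmodType R)
    (d : forall i, {linear P i.+1 -> P i}) (e : {linear P 0%N -> M})
    (psi : {linear P n -> P n.+1}) :
    (forall i, fg_projective (P i)) ->
    (forall z, exists x, e x = z) ->
    (forall x, e x = 0 <-> exists z, d 0%N z = x) ->
    (forall i x, d i x = 0 <-> exists z, d i.+1 z = x) ->
    (forall x, psi (d n x) = x) ->
  has_resolution fg_projective M n.
Proof.
elim: n M P d e psi => [|n IH] M P d e psi CP e_surj e_ker d_ker psiK.
  have [s es] := split_retract e_surj e_ker psiK.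
  apply: has_resolution0; first exact: fg_projective0.
  exact: fg_projective_retract es (CP 0%N).
have ed u : e (d 0%N u) = 0 by apply/e_ker; exists u.
apply: (has_resolution_cons (iota := [the {linear kernel e -> P 0%N} of val]))
  (CP 0%N) e_surj val_inj (@kervalE _ _ _ e) _.
apply: (IH _ (fun i => P i.+1) (fun i => d i.+1)
  [the {linear P 1%N -> kernel e} of to_kernel ed] psi) => //.
- move=> z; have /e_ker[w wz] := kervalP z.
  by exists w; apply: val_inj.
- move=> x; rewrite -d_ker; split=> [/(congr1 val)//|dx].
  by apply: val_inj.
Qed.

Lemma resolution_length_le_dim M m n :
    (forall P, prime_ideal P -> ~ prime_chain [set (0 : R)] P n.+1) ->
    has_resolution fg_projective M m ->
  exists2 k, (k <= n)%N & has_resolution fg_projective M k.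
Proof.
move=> ht; elim: m => [|m IH] resM; first by exists 0%N.
have [mn|nm] := leqP m.+1 n; first by exists m.+1.
apply: IH; case: resM => P [d [e [CP P0 e_surj e_ker d_ker]]].
(* The leftmost map is [d m], since [P m.+2] is zero; splitting it saves one step. *)
have [|||psi psiK] := @split_top R P d d_ker _ _ n m nm _ ht.
- by move=> i; case: (CP i).
- by move=> i; case: (CP i).
- exact: P0.
exact: shorten_resolution CP e_surj e_ker d_ker psiK.
Qed.

End Resolutions.

(** * Comparison of the two dimensions *)

Theorem theorem3p5 (R : comPzRingType) : (fPD R <= krull_dim R)%E.
Proof.
apply: (eint_sup_supremums _).2 => _ [M [m resM] ->]; rewrite /proj_dim.
case: asboolP => [_|Mn0]; first exact: leNye.
have [ub_dim _] := eint_sup_supremums [set k%:Z%:E | k in has_prime_chain R].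
rewrite -/(krull_dim R) in ub_dim.
have chain_le k : has_prime_chain R k -> (k%:Z%:E <= krull_dim R)%E.
  by move=> ck; apply: ub_dim; exists k.
(* A nonzero [M] forces [R] to be nonzero, so a prime exists and the dimension is not [-oo]. *)
have R1 : (1 : R) <> 0.
  by move=> R1; apply: Mn0 => x; rewrite -[x]scale1r R1 scale0r.
have [|||P [pP _ _]] := @exists_prime R [set 0] [set 1] (set0_ideal R).
- by [].
- by move=> x z -> ->; rewrite mulr1.
- by move=> x -> /esym.
have /chain_le : has_prime_chain R 0 by exists (fun=> P); split.
case dimR : (krull_dim R) => [r||];
  [|by move=> _; exact: leey|by rewrite leeNy_eq].
rewrite lee_fin => r0.
have [|k kr [Q [d [e [CQ Q0 e_surj e_ker d_ker]]]]] :=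
    @resolution_length_le_dim R M m `|r|%N _ resM.
  (* A chain of length [r + 1] would exceed the dimension [r]. *)
  move=> P' _ [p [pp plt]].
  have /chain_le : has_prime_chain R `|r|.+1.
    by exists p; split=> // i /pp[].
  by rewrite dimR lee_fin -addn1 PoszD gez0_abs // gerDl.
apply: (@le_trans _ _ k%:Z%:E); last first.
  by rewrite lee_fin -(gez0_abs r0) lez_nat.
apply: (eint_inf_infimums _).1; exists k => //.
by exists Q, d, e; split=> // i; case: (CQ i).
Qed.
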